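(* Let $S$ be a finitely generated polynomial semigroup and let $g_1,g_2,\dots,g_N$ (not necessarily distinct) be polynomials such that $S=\langle g_1,g_2,\dots,g_N\rangle$. Assume that the set $$C^*(g_1,\dots,g_N):=\{c\in\mathbb{C}: g_i'(c)=0\text{ for some }i\in\{1,\dots,N\}\}$$ satisfies $\sharp C^*(g_1,\dots,g_N)>1$. Let $D:=\sum_{i=1}^N\deg(g_i)$, $M:=\max\{|g_i'(z)|: z\in J(S),\ i\in\{1,\dots,N\}\}$, $R:=D/N$ and $\lambda:=\log R/\log M$. Then there exist $r_0>0$ and $\kappa\in\mathbb{Z}_+$ such that for any $r\in(0,r_0]$ and $y\in J(S)$ we have $$\sharp\big((F^n)^{\dagger}(y)\cap D(z,r)\big)^{\bullet}\leq\max\Big(D^{\,n-\frac{\nu}{\kappa}+1}N^{\frac{\nu}{\kappa}-1},\ \big(D-\tfrac12\big)^n\Big)$$ for all $n\in\mathbb{N}$ and $z\in\mathbb{C}$, where $\nu\in\mathbb{Z}_+$ is the unique positive integer such that $$r\in I(\nu):=\Big(r_0R^{-2\nu/\lambda},\ r_0R^{-2(\nu-1)/\lambda}\Big].$$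
   Context: Let $\widehat{\mathbb{C}}$ be the Riemann sphere. A rational semigroup is a subsemigroup (under composition) of the semigroup of holomorphic self-maps of $\widehat{\mathbb{C}}$ containing no constant maps. A rational semigroup $S$ is a polynomial semigroup if all its elements are polynomials, any degree-one element of $S$ has an attracting fixed point at $\infty$ (i.e., is $z\mapsto az+b$ with $|a|>1$), and $S$ contains at least one element of degree at least $2$. $S=\langle g_1,\dots,g_N\rangle$ means that $S$ is the set of all finite (nonempty) compositions of $g_1,\dots,g_N$. The Fatou set $F(S)$ is the largest open subset of $\widehat{\mathbb{C}}$ on which the functions in $S$ form a normal family, and the Julia set is $J(S):=\widehat{\mathbb{C}}\setminus F(S)$; for finitely generated polynomial semigroups, $J(S)$ is a compact subset of $\mathbb{C}$. One has $R>1$ and $M>1$, so $\lambda>0$ and $M=R^{1/\lambda}$. $D(z,r)$ is the open disc with centre $z\in\mathbb{C}$ and radius $r$ (not to be confused with the integer $D$). $\mathbb{N}=\{0,1,2,\dots\}$ and $\mathbb{Z}_+=\{1,2,\dots\}$. Let $\Gamma:=\sum_{1\leq i\leq N}\mathrm{graph}(g_i)$ be the holomorphic correspondence on $\widehat{\mathbb{C}}$ determined by the list $g_1,\dots,g_N$, and let $(F^n)^{\dagger}$ be the set-valued map induced by the $n$-fold iterate of its adjoint; concretely, $(F^0)^{\dagger}(y):=\{y\}$ and, for $n\geq1$, $(F^n)^{\dagger}(y)=\bigcup_{(i_1,\dots,i_n)\in\{1,\dots,N\}^n}(g_{i_n}\circ\dots\circ g_{i_1})^{-1}\{y\}$. The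 superscript $\bullet$ indicates a list in which objects are repeated according to multiplicity, and $\sharp A^{\bullet}$ is the number of objects of the list counted with multiplicity. Thus, for $n\geq1$, $$\sharp\big((F^n)^{\dagger}(y)\cap D(z,r)\big)^{\bullet}=\sum_{(i_1,\dots,i_n)\in\{1,\dots,N\}^n}\ \sum_{x\in D(z,r),\ g_{i_n}\circ\dots\circ g_{i_1}(x)=y}\mathrm{ord}_x(g_{i_n}\circ\dots\circ g_{i_1}),$$ where $\mathrm{ord}_x(g)$ is the multiplicity of $x$ as a zero of $g-g(x)$; for $n=0$ it is $1$ if $y\in D(z,r)$ and $0$ otherwise. *)

(* Defs.v *)
From HB Require Import structures.
From mathcomp Require Import all_boot all_order all_algebra complex.
From mathcomp Require Import all_classical all_reals all_analysis.

Set Implicit Arguments.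
Unset Strict Implicit.
Unset Printing Implicit Defensive.

Import Order.TTheory GRing.Theory Num.Theory.
Import numFieldNormedType.Exports.

Local Open Scope classical_set_scope.
Local Open Scope ring_scope.

(* [complex] carries no topology of its own: give it that of its norm. *)
Set Warnings "-redundant-canonical-projection".
HB.instance Definition _ (R : realType) :=
  NormedModule.copy (complex R) ((complex R)^o).
Set Warnings "redundant-canonical-projection".

(* The norm [`|z|] of [z : R[i]] lives in [R[i]]; this is the same number
   as an element of [R]. *)
Definition modulus (R : realType) (z : R[i]) : R := complex.Re `|z|.

Definition disc (R : realType) (z : R[i]) (r : R) : set R[i] :=
  [set x | modulus (x - z) < r].

(* [Some z] is the point z of the plane, [None] the point at infinity. *)
Definition sphere (R : realType) := one_point_compactification R[i].

Definition chordal (R : realType) (a b : sphere R) : R :=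
  match a, b with
  | Some z, Some w =>
      2 * modulus (z - w) /
        (Num.sqrt (1 + modulus z ^+ 2) * Num.sqrt (1 + modulus w ^+ 2))
  | Some z, None | None, Some z => 2 / Num.sqrt (1 + modulus z ^+ 2)
  | None, None => 0
  end.

(* The limit takes values in the sphere, so that locally uniform divergence
   to infinity counts as convergence. *)
Definition normal_family (R : realType)
    (U : set (sphere R)) (F : set (sphere R -> sphere R)) : Prop :=
  forall f : nat -> sphere R -> sphere R, (forall k, F (f k)) ->
  exists (phi : nat -> nat) (h : sphere R -> sphere R),
    {homo phi : j k / (j < k)%N} /\
    forall K : set (sphere R), compact K -> K `<=` U ->
    forall e : R, 0 < e ->
      \forall k \near \oo, forall a, K a -> chordal (f (phi k) a) (h a) < e.

(* The extension to the sphere of a nonconstant polynomial. *)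
Definition sphere_map (R : realType) (p : {poly R[i]}) : sphere R -> sphere R :=
  omap (fun z => p.[z]).

(* Normality is a local property, so this union is itself an open set on which
   the family is normal: it is the largest one. *)
Definition fatou (R : realType) (S : set {poly R[i]}) : set (sphere R) :=
  \bigcup_(U in [set U | open U /\ normal_family U (@sphere_map R @` S)]) U.

Definition julia (R : realType) (S : set {poly R[i]}) : set (sphere R) :=
  ~` fatou S.

(* [size p] is the degree of [p] plus one. *)
Definition polynomial_semigroup (R : realType) (S : set {poly R[i]}) : Prop :=
  [/\ forall p q, S p -> S q -> S (p \Po q),
      forall p, S p -> (1 < size p)%N,
      forall p, S p -> size p = 2%N -> 1 < modulus (lead_coef p) &
      exists2 p, S p & (2 < size p)%N].

(* g_(i_n) o ... o g_(i_1) for the word w = [:: i_1; ...; i_n]. *)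
Definition word_poly (R : realType) (N : nat) (g : 'I_N -> {poly R[i]})
    (w : seq 'I_N) : {poly R[i]} :=
  foldl (fun p i => g i \Po p) 'X w.

Definition generated_semigroup (R : realType) (N : nat)
    (g : 'I_N -> {poly R[i]}) : set {poly R[i]} :=
  [set p | exists2 w : seq 'I_N, w != [::] & p = word_poly g w].

Definition critical_points (R : realType) (N : nat)
    (g : 'I_N -> {poly R[i]}) : set R[i] :=
  [set c | exists i : 'I_N, (g i)^`().[c] = 0].

(* The multiplicity of x as a zero of p - p(x). *)
Definition ord_at (R : realType) (x : R[i]) (p : {poly R[i]}) : nat :=
  mup x (p - (p.[x])%:P).

(* The number of points of the n-th backward image of y in D(z, r), with
   multiplicity; for n = 0 the only word is empty and its polynomial is 'X. *)
Definition preimage_count (R : realType) (N : nat) (g : 'I_N -> {poly R[i]})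
    (n : nat) (y z : R[i]) (r : R) : nat :=
  (\sum_(w : n.-tuple 'I_N)
     \big[addn/0]_(x \in disc z r `&` [set x | (word_poly g w).[x] = y])
       ord_at x (word_poly g w))%N.

Definition degree_sum (R : realType) (N : nat) (g : 'I_N -> {poly R[i]}) : nat :=
  (\sum_(i < N) (size (g i)).-1)%N.

(* The maximum of |g_i'| over the Julia set and over i; it is attained since
   the Julia set is compact. *)
Definition max_derivative (R : realType) (N : nat) (S : set {poly R[i]})
    (g : 'I_N -> {poly R[i]}) : R :=
  sup [set m | exists (i : 'I_N) (z : R[i]),
                 julia S (Some z) /\ m = modulus (g i)^`().[z]].

(* Main.v *)
(* Let D = sum of deg g_i. By Gauss-Lucas, if a disc contains a whole fibre of
   each g_i then it contains all critical points; as there are at least two of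
   them, in a small disc no point has more than deg g_i - 1 preimages under g_i
   for some i, so a small disc contributes a factor D - 1 instead of D. Backward images of y in J(S) stay in J(S), and near J(S)
   each g_i expands distances by at most M^2, so for r in I(nu) the discs stay
   small for nu steps. The count is therefore at most
   (D - 1)^min(n, nu) D^(n - min(n, nu)), and kappa is any integer with
   (1 - 1/D)^kappa <= N/D.

   That M > 1 is seen at a point a of J(S) of largest modulus: some word f of
   length n keeps the orbit of a in J(S), so |f'(a)| <= M^n, while
   f'(a) / (f(a) - v) is the sum of 1 / (a - x) over the fibre of v in J(S),
   whose modulus is at least deg f / (2|a|) because |x| <= |a|. *)

Require Import Defs.
From mathcomp Require Import all_boot all_order all_algebra complex.
From mathcomp Require Import all_classical all_reals all_analysis.
From mathcomp Require Import ring lra.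

Set Implicit Arguments.
Unset Strict Implicit.
Unset Printing Implicit Defensive.

Import Order.TTheory GRing.Theory Num.Theory.
Import numFieldNormedType.Exports.

Local Open Scope classical_set_scope.
Local Open Scope card_scope.
Local Open Scope ring_scope.

(** * The modulus and the topology of the plane *)

Section Modulus.
Variable R : realType.
Implicit Types (x y z : R[i]) (p : {poly R[i]}).

Lemma norm_modulus z : `|z| = (modulus z)%:C%C.
Proof. by rewrite /modulus normc_def. Qed.

Lemma modulus_ge0 z : 0 <= modulus z.
Proof. by rewrite /modulus normc_def /= sqrtr_ge0. Qed.

Lemma modulusM x y : modulus (x * y) = modulus x * modulus y.
Proof.
apply: (@complexI R); rewrite rmorphM /= -!norm_modulus; exact: normrM.
Qed.

Lemma modulus0 : modulus (0 : R[i]) = 0.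
Proof. by rewrite /modulus normr0. Qed.

Lemma modulus1 : modulus (1 : R[i]) = 1.
Proof. by rewrite /modulus normr1. Qed.

Lemma modulusN z : modulus (- z) = modulus z.
Proof. by rewrite /modulus normrN. Qed.

Lemma modulusC x y : modulus (x - y) = modulus (y - x).
Proof. by rewrite /modulus distrC. Qed.

Lemma modulus_eq0 z : (modulus z == 0) = (z == 0).
Proof.
apply/idP/eqP => [/eqP h|->]; last by rewrite modulus0.
by apply/eqP; rewrite -normr_eq0 norm_modulus h.
Qed.

Lemma modulus_gt0 z : (0 < modulus z) = (z != 0).
Proof. by rewrite lt_neqAle modulus_ge0 andbT eq_sym modulus_eq0. Qed.

Lemma modulusD x y : modulus (x + y) <= modulus x + modulus y.
Proof.
by have := ler_normD x y; rewrite !norm_modulus -rmorphD lecR.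
Qed.

Lemma modulusB x y z : modulus (x - z) <= modulus (x - y) + modulus (y - z).
Proof. by rewrite -[x - z](subrKA y) modulusD. Qed.

Lemma modulus_subl x y : modulus x - modulus y <= modulus (x + y).
Proof.
by rewrite lerBlDr -(modulusN y) -{1}[x](addrK y) modulusD.
Qed.

Lemma modulusX z n : modulus (z ^+ n) = modulus z ^+ n.
Proof.
by elim: n => [|n IH]; rewrite ?expr0 ?modulus1 // !exprS modulusM IH.
Qed.

Lemma modulus_prod I (r : seq I) (P : pred I) (F : I -> R[i]) :
  modulus (\prod_(i <- r | P i) F i) = \prod_(i <- r | P i) modulus (F i).
Proof. by apply: (big_morph _ modulusM modulus1). Qed.

Lemma Re_le_modulus z : complex.Re z <= modulus z.
Proof.
by have := normc_ge_Re z; rewrite norm_modulus lecR; apply/le_trans/ler_norm.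
Qed.

Lemma modulus_le_ReIm z :
  modulus z <= `|complex.Re z| + `|complex.Im z|.
Proof.
case: z => a b; rewrite /modulus normc_def /=.
rewrite -(@ler_pXn2r _ 2) ?nnegrE ?sqrtr_ge0 ?addr_ge0 //.
rewrite sqr_sqrtr ?addr_ge0 ?sqr_ge0 // sqrrD !real_normK ?num_real //.
by rewrite lerD2r lerDl mulrn_wge0 // mulr_ge0.
Qed.

Lemma ReIm_le_modulus z :
  `|complex.Re z| <= modulus z /\ `|complex.Im z| <= modulus z.
Proof.
case: z => a b; rewrite /modulus normc_def /= -!sqrtr_sqr.
by split; rewrite ler_sqrt ?addr_ge0 ?sqr_ge0 // ?lerDl ?lerDr sqr_ge0.
Qed.

Lemma sqr_modulus z : modulus z ^+ 2 = complex.Re z ^+ 2 + complex.Im z ^+ 2.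
Proof.
by case: z => a b; rewrite /modulus normc_def /= sqr_sqrtr // addr_ge0 ?sqr_ge0.
Qed.

Lemma nbhs_disc z (A : set R[i]) :
  nbhs z A <-> exists2 r : R, 0 < r & disc z r `<=` A.
Proof.
split.
  move=> /nbhs_ballP[e /= e0 eA].
  have eE : e = (complex.Re e)%:C%C by rewrite RRe_real // gtr0_real.
  exists (complex.Re e); first by rewrite -ltcR -eE.
  move=> x dx; apply: eA; rewrite -ball_normE /= eE norm_modulus ltcR modulusC.
  exact: dx.
case=> r r0 rA; apply/nbhs_ballP; exists (r%:C%C) => /=; first by rewrite ltcR.
by move=> x; rewrite -ball_normE /= norm_modulus ltcR modulusC => /rA.
Qed.

Lemma nbhs_some_disc z (A : set (sphere R)) :
  nbhs (Some z : sphere R) A <-> exists2 r : R, 0 < r & disc z r `<=` Some @^-1` A.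
Proof. exact: nbhs_disc. Qed.

(** Compactness in the plane comes from here: a continuous image of a product of two segments. *)
Definition square (r : R) : set R[i] :=
  (fun xy : R * R => Complex xy.1 xy.2) @` (`[-r, r] `*` `[-r, r]).

Lemma Complex_continuous : continuous (fun xy : R * R => Complex xy.1 xy.2 : R[i]).
Proof.
move=> [a b] A /nbhs_disc[r r0 rA].
near=> xy => /=; apply: rA; rewrite /disc /=.
apply: (le_lt_trans (modulus_le_ReIm _)) => /=.
rewrite [ltRHS](splitr r) ltrD //.
- near: xy; exists (ball a (r / 2), ball b (r / 2)) => /=.
    by split; apply: nbhsx_ballx; rewrite divr_gt0.
  by move=> [c d] /= []; rewrite -ball_normE /= distrC.
- near: xy; exists (ball a (r / 2), ball b (r / 2)) => /=.
    by split; apply: nbhsx_ballx; rewrite divr_gt0.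
  by move=> [c d] /= [] _; rewrite -ball_normE /= distrC.
Unshelve. all: by end_near. Qed.

Lemma compact_square r : compact (square r).
Proof.
apply: continuous_compact.
  exact/continuous_subspaceT/Complex_continuous.
by apply: compact_setX; exact: segment_compact.
Qed.

Lemma modulus_le_square z r : modulus z <= r -> square r z.
Proof.
have [h1 h2] := ReIm_le_modulus z => zr.
exists (complex.Re z, complex.Im z); last by case: (z).
by split; rewrite /= in_itv /= -ler_norml; apply: le_trans zr.
Qed.

Lemma square_modulus_le z r : square r z -> modulus z <= 2 * r.
Proof.
move=> [[a b] /= []]; rewrite !in_itv /= -!ler_norml => ar br <-.
by rewrite (le_trans (modulus_le_ReIm _)) //= mulr2n mulrDl mul1r lerD.
Qed.

Lemma modulus_continuous : continuous (@modulus R).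
Proof.
move=> z A /nbhs_ballP[e /= e0 eA]; apply/nbhs_disc; exists e => // x.
rewrite /disc /= => xz; apply: eA; rewrite -ball_normE /=.
have h1 := modulus_subl z (x - z); have h2 := modulus_subl x (z - x).
rewrite !subrKC (modulusC z x) in h1 h2.
by rewrite ltr_norml; apply/andP; split; lra.
Qed.

End Modulus.

(** * Fibres of polynomials and the Gauss-Lucas theorem *)

Section Fibers.
Variable R : realType.
Implicit Types (x y z u : R[i]) (p q : {poly R[i]}).

(** A list and not a set: for nonconstant [p] each point occurs as often as its multiplicity, so
    weighted counting becomes [count]. *)
Definition fiber p u : seq R[i] := sval (closed_field_poly_normal (p - u%:P)).

Lemma size_subC p u : (1 < size p)%N -> size (p - u%:P) = size p.
Proof.
by move=> p1; rewrite size_polyDl // size_polyN (leq_ltn_trans (size_polyC_leq1 _)).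
Qed.

Lemma fiberE p u : (1 < size p)%N ->
  p - u%:P = lead_coef p *: \prod_(x <- fiber p u) ('X - x%:P).
Proof.
move=> p1; rewrite /fiber; case: closed_field_poly_normal => r /= {1}->.
by rewrite lead_coefDl // size_polyN (leq_ltn_trans (size_polyC_leq1 _)).
Qed.

Lemma lead_coef_neq0 p : (1 < size p)%N -> lead_coef p != 0.
Proof. by rewrite lead_coef_eq0 -size_poly_gt0 => /ltnW. Qed.

Lemma size_fiber p u : (1 < size p)%N -> size (fiber p u) = (size p).-1.
Proof.
move=> p1; rewrite -(size_subC u p1) fiberE // size_scale ?lead_coef_neq0 //.
by rewrite size_prod_XsubC.
Qed.

Lemma horner_fiber p u z : (1 < size p)%N ->
  p.[z] - u = lead_coef p * \prod_(x <- fiber p u) (z - x).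
Proof.
move=> p1; rewrite -[u in LHS](hornerC u z) -hornerN -hornerD fiberE //.
by rewrite hornerZ horner_prod; congr (_ * _); apply: eq_bigr => i _; rewrite hornerXsubC.
Qed.

Lemma mem_fiber p u x : (1 < size p)%N -> (x \in fiber p u) = (p.[x] == u).
Proof.
move=> p1; rewrite -subr_eq0 horner_fiber // mulf_eq0 (negPf (lead_coef_neq0 p1)) /=.
by rewrite prodf_seq_eq0; apply/idP/hasP => [xf|[y yf /=]];
  [exists x; rewrite //= subrr | rewrite subr_eq0 => /eqP ->].
Qed.

Lemma ord_at_fiber p x : (1 < size p)%N ->
  ord_at x p = count_mem x (fiber p p.[x]).
Proof.
move=> p1; rewrite /ord_at fiberE // -mul_polyC mupMr ?mu_prod_XsubC //.
by rewrite rootC lead_coef_neq0.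
Qed.

Lemma sum_undup_count (T : eqType) (s : seq T) (P : pred T) :
  (\sum_(x <- undup s | P x) count_mem x s)%N = count P s.
Proof.
rewrite -sum1_count -[RHS]big_undup_iterop_count /=; apply: eq_bigr => x _.
by elim: (count _ _) => // n IH; rewrite iteropS -iterSr iter_addn_0 mul1n.
Qed.

(** Turns the weighted sum in [preimage_count] into a plain count along a list, the form in which
    recursion on words is possible. *)
Lemma sum_ord_at p u (A : set R[i]) : (1 < size p)%N ->
  (\big[addn/0]_(x \in A `&` [set x | p.[x] = u]) ord_at x p)%N
  = count (fun x => x \in A) (fiber p u).
Proof.
move=> p1; rewrite -sum_undup_count fsbig_mkcondl.
rewrite (fsbigE (undup (fiber p u))) ?undup_uniq //; first last.
- by move=> i /= piu; rewrite mem_undup mem_fiber // piu eqxx.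
- by move=> i /=; rewrite mem_undup mem_fiber // => /eqP.
rewrite [RHS]big_mkcond big_seq_cond [RHS]big_seq_cond.
rewrite [LHS]big_mkcond [RHS]big_mkcond; apply: eq_bigr => i _.
rewrite mem_undup mem_fiber //=; case: eqP => /= piu; last first.
  by rewrite memNset.
by rewrite mem_set // ord_at_fiber // piu.
Qed.

Lemma size_comp_gt1 p q : (1 < size p)%N -> (1 < size q)%N ->
  (1 < size (q \Po p))%N.
Proof.
move=> p1 q1; have := size_comp_poly q p.
by case: (size (q \Po p)) (size q) (size p) p1 q1 => [|[|n]] // [|[|m]] // [|[|k]].
Qed.

(** Substituting [p] into the factorisation of [q - u] turns each factor [X - v] into [p - v], which
    splits again; comparing linear factors gives the permutation. *)
Lemma fiber_comp p q u : (1 < size p)%N -> (1 < size q)%N ->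
  perm_eq (fiber (q \Po p) u) (flatten [seq fiber p v | v <- fiber q u]).
Proof.
move=> p1 q1; apply: prod_XsubC_eq.
have qp1 := size_comp_gt1 p1 q1.
have := congr1 (fun s => s \Po p) (fiberE u q1).
rewrite comp_polyB comp_polyC fiberE // comp_polyZ.
have -> : \prod_(x <- fiber q u) ('X - x%:P) \Po p
    = lead_coef p ^+ (size q).-1 *:
      \prod_(x <- flatten [seq fiber p v | v <- fiber q u]) ('X - x%:P).
  rewrite -(size_fiber u q1); elim: (fiber q u) => [|x s IH] /=.
    by rewrite !big_nil comp_polyC scale1r.
  rewrite big_cons comp_polyM IH comp_polyB comp_polyX comp_polyC fiberE //.
  by rewrite big_cat /= -scalerAl -scalerAr scalerA -exprS.
rewrite scalerA -lead_coef_comp //.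
by apply/scalerI; rewrite lead_coef_neq0.
Qed.

Lemma deriv_prod_XsubC (s : seq R[i]) z : z \notin s ->
  (\prod_(x <- s) ('X - x%:P))^`().[z]
  = (\prod_(x <- s) (z - x)) * \sum_(x <- s) (z - x)^-1.
Proof.
elim: s => [|x s IH]; first by rewrite !big_nil derivC horner0 mulr0.
rewrite inE negb_or => /andP[zx /IH {}IH]; rewrite !big_cons.
rewrite derivM derivXsubC mul1r hornerD hornerM IH hornerXsubC horner_prod.
under eq_bigr do rewrite hornerXsubC.
have : z - x != 0 by rewrite subr_eq0.
set P := \prod_(_ <- _) _; set s' := \sum_(_ <- _) _ => zx0.
by field.
Qed.

(** The logarithmic derivative of [p - u]; it serves both Gauss-Lucas and the lower bound on the
    maximal derivative. *)
Lemma deriv_fiber p u z : (1 < size p)%N -> p.[z] != u ->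
  p^`().[z] = (p.[z] - u) * \sum_(x <- fiber p u) (z - x)^-1.
Proof.
move=> p1 pz; rewrite -[p in LHS](subrK u%:P) derivD derivC addr0 fiberE //.
rewrite derivZ hornerZ deriv_prod_XsubC ?mem_fiber // horner_fiber //.
by rewrite mulrA.
Qed.

(** The map s -> 1/(1 - s) sends the closed unit disc without 1 into the half-plane Re >= 1/2; here
    s = t/b. Clearing denominators leaves |t|^2 <= |b|^2. *)
Lemma Re_div_sub (b t : R[i]) : t != b -> modulus t <= modulus b ->
  1 / 2 <= complex.Re (b / (b - t)).
Proof.
move=> tb; rewrite -[modulus t <= _](@ler_pXn2r _ 2) ?nnegrE ?modulus_ge0 //.
rewrite !sqr_modulus.
case: b t tb => b1 b2 [t1 t2] /= tb h.
have n0 : 0 < (b1 - t1) ^+ 2 + (b2 - t2) ^+ 2.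
  rewrite lt_neqAle addr_ge0 ?sqr_ge0 // andbT eq_sym paddr_eq0 ?sqr_ge0 //.
  rewrite !sqrf_eq0 !subr_eq0; apply: contra tb => /andP[/eqP -> /eqP ->].
  by [].
set n := (_ + _) in n0 *.
rewrite [leRHS](_ : _ = (b1 * (b1 - t1) + b2 * (b2 - t2)) / n); last first.
  by ring.
by rewrite ler_pdivlMr // /n; nra.
Qed.

Lemma Re_sum_div_sub (b : R[i]) (s : seq R[i]) :
  (forall t, t \in s -> t != b /\ modulus t <= modulus b) ->
  (size s)%:R / 2 <= complex.Re (b * \sum_(t <- s) (b - t)^-1).
Proof.
elim: s => [|t s IH] h; first by rewrite big_nil mulr0 mul0r.
rewrite big_cons mulrDr raddfD /= -natr1 mulrDl addrC lerD //.
  by have [] := h t (mem_head _ _); exact: Re_div_sub.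
by apply: IH => t' ts; apply: h; rewrite inE ts orbT.
Qed.

(* Gauss-Lucas, for a disc. *)
Lemma critical_point_disc p u z r c : (1 < size p)%N ->
  (forall x, x \in fiber p u -> disc z r x) -> p^`().[c] = 0 -> disc z r c.
Proof.
move=> p1 fD pc0; apply: contrapT => /negP; rewrite -leNgt => rc.
have cf x : x \in fiber p u -> x - z != c - z /\ modulus (x - z) <= modulus (c - z).
  move=> xf; have xz := lt_le_trans (fD _ xf) rc; split; last exact: ltW.
  by apply/eqP => e; rewrite e ltxx in xz.
have cu : p.[c] != u by rewrite -mem_fiber //; apply/negP => /cf[]; rewrite eqxx.
have /eqP := deriv_fiber p1 cu.
rewrite pc0 eq_sym mulf_eq0 subr_eq0 (negPf cu) /= => /eqP s0.
(* With [z] as origin, every fibre point is closer than [c], so [c - z] times the sum has real part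
   at least half the degree; a zero of the derivative makes that sum vanish. *)
have := @Re_sum_div_sub (c - z) [seq x - z | x <- fiber p u].
rewrite big_map size_map size_fiber //.
under eq_bigr => x _ do rewrite opprB addrA subrK.
rewrite s0 mulr0 /= => h; have /h : forall t, t \in [seq x - z | x <- fiber p u] ->
    t != c - z /\ modulus t <= modulus (c - z) by move=> t /mapP[x /cf ? ->].
by rewrite leNgt divr_gt0 // ltr0n -subn1 subn_gt0.
Qed.

End Fibers.
(** * Estimates for polynomials *)

Section Estimates.
Variable R : realType.
Implicit Types (x y z u : R[i]) (p q : {poly R[i]}).

Lemma horner_bounded p (B : R) :
  exists2 C : R, 0 <= C & forall z, modulus z <= B -> modulus p.[z] <= C.
Proof.
elim/poly_ind: p => [|p c [C C0 hC]].
  by exists 0 => // z _; rewrite horner0 modulus0.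
exists (C * `|B| + modulus c); first by rewrite addr_ge0 ?mulr_ge0 ?modulus_ge0.
move=> z zB; rewrite !hornerE (le_trans (modulusD _ _)) // lerD2r modulusM.
by rewrite ler_pM ?modulus_ge0 ?hC // (le_trans zB) ?ler_norm.
Qed.

Lemma horner_lipschitz p (B : R) :
  exists2 C : R, 0 <= C & forall x z, modulus x <= B -> modulus z <= B ->
    modulus (p.[x] - p.[z]) <= C * modulus (x - z).
Proof.
elim/poly_ind: p => [|p c [C C0 hC]].
  by exists 0 => // x z _ _; rewrite !horner0 subrr modulus0 mul0r.
have [C' C'0 hC'] := horner_bounded p B.
exists (C * `|B| + C'); first by rewrite addr_ge0 ?mulr_ge0.
move=> x z xB zB; rewrite !hornerE.
have -> : p.[x] * x + c - (p.[z] * z + c)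
  = (p.[x] - p.[z]) * x + p.[z] * (x - z) by ring.
rewrite (le_trans (modulusD _ _)) // !modulusM mulrDl lerD //.
  rewrite mulrAC ler_pM ?modulus_ge0 ?hC //.
  by rewrite (le_trans xB) ?ler_norm.
by rewrite ler_wpM2r ?modulus_ge0 ?hC'.
Qed.

Lemma horner_taylor p (B : R) :
  exists2 C : R, 0 <= C & forall x z, modulus x <= B -> modulus z <= B ->
    modulus (p.[x] - p.[z] - p^`().[z] * (x - z)) <= C * modulus (x - z) ^+ 2.
Proof.
elim/poly_ind: p => [|p c [C C0 hC]].
  exists 0 => // x z _ _.
  by rewrite deriv0 !horner0 subrr mul0r subrr modulus0 mul0r.
have [C' C'0 hC'] := horner_bounded p^`() B.
exists (C * `|B| + C'); first by rewrite addr_ge0 ?mulr_ge0.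
move=> x z xB zB; rewrite derivMXaddC !(hornerD, hornerM, hornerX, hornerC).
have -> : p.[x] * x + c - (p.[z] * z + c) - (p.[z] + p^`().[z] * z) * (x - z)
  = (p.[x] - p.[z] - p^`().[z] * (x - z)) * x + p^`().[z] * (x - z) ^+ 2 by ring.
rewrite (le_trans (modulusD _ _)) // !(modulusX, modulusM) mulrDl lerD //.
  rewrite mulrAC ler_pM ?modulus_ge0 ?hC //.
  by rewrite (le_trans xB) ?ler_norm.
by rewrite ler_wpM2r ?exprn_ge0 ?modulus_ge0 ?hC'.
Qed.

Lemma horner_near p z (e : R) : 0 < e ->
  exists2 d : R, 0 < d & forall x, disc z d x -> disc p.[z] e p.[x].
Proof.
move=> e0; have [C C0 hC] := horner_lipschitz p (modulus z + 1).
have C1 : 0 < C + 1 by rewrite ltr_wpDl.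
exists (Num.min 1 (e / (C + 1))); first by rewrite lt_min ltr01 divr_gt0.
move=> x; rewrite /disc /= lt_min ltr_pdivlMr // => /andP[x1 xe].
rewrite (le_lt_trans (hC _ _ _ _)) ?lerDl //.
  by rewrite -[x](subrK z) addrC (le_trans (modulusD _ _)) // lerD2l ltW.
by rewrite (le_lt_trans _ xe) // mulrC ler_wpM2l ?modulus_ge0 // lerDl.
Qed.

(* If all roots of [p - w] were at distance at least [e] from [z], then
   [p.[z] - w], the product of the distances, would be large. *)
Lemma horner_open p z (e : R) : (1 < size p)%N -> 0 < e ->
  exists2 d : R, 0 < d &
    forall w, disc p.[z] d w -> exists2 x, disc z e x & p.[x] = w.
Proof.
move=> p1 e0; exists (modulus (lead_coef p) * e ^+ (size p).-1).
  by rewrite mulr_gt0 ?exprn_gt0 // modulus_gt0 lead_coef_neq0.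
move=> w; rewrite /disc /= modulusC horner_fiber // modulusM modulus_prod.
rewrite ltr_pM2l ?modulus_gt0 ?lead_coef_neq0 // -(size_fiber w p1) => h.
apply: contrapT => nex; move: h; apply/negP; rewrite -leNgt.
have: forall x, x \in fiber p w -> e <= modulus (z - x).
  move=> x; rewrite mem_fiber // => /eqP px; rewrite leNgt modulusC.
  by apply/negP => xz; apply: nex; exists x.
elim: (fiber p w) => [|x s IH] h; first by rewrite big_nil expr0.
rewrite big_cons /= exprS ler_pM ?exprn_ge0 ?(ltW e0) ?h ?mem_head //.
by apply: IH => y ys; apply: h; rewrite inE ys orbT.
Qed.

Lemma horner_bounded_below p : p != 0 ->
  exists m B : R, [/\ 0 < m, 0 < B & forall z, B <= modulus z -> m <= modulus p.[z]].
Proof.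
elim/poly_ind: p => [|p c IH]; first by rewrite eqxx.
have [->|/IH[m [B [m0 B0 h]]] _] := eqVneq p 0.
  rewrite mul0r add0r polyC_eq0 => c0; exists (modulus c), 1.
  by split; rewrite ?modulus_gt0 // => z _; rewrite hornerC.
exists m, (Num.max B (1 + modulus c / m)); split=> //; first by rewrite lt_max B0.
move=> z; rewrite ge_max => /andP[zB zc]; rewrite !hornerE.
apply: le_trans (modulus_subl _ _); rewrite modulusM lerBrDr.
have hc : m + modulus c <= m * modulus z.
  by rewrite mulrC -ler_pdivrMr // mulrDl divff ?gt_eqF.
by rewrite (le_trans hc) // ler_wpM2r ?modulus_ge0 ?h.
Qed.

Lemma horner_infinity p (A : R) : (1 < size p)%N ->
  exists2 B : R, 0 < B & forall z, B <= modulus z -> A <= modulus p.[z].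
Proof.
elim/poly_ind: p => [|p c _]; first by rewrite size_poly0.
have [->|p0 _] := eqVneq p 0.
  by rewrite mul0r add0r ltnNge size_polyC_leq1.
have [m [B [m0 B0 h]]] := horner_bounded_below p0.
exists (Num.max B ((`|A| + modulus c) / m)); first by rewrite lt_max B0.
move=> z; rewrite ge_max => /andP[zB zc]; rewrite !hornerE.
apply: le_trans (modulus_subl _ _); rewrite modulusM lerBrDr.
rewrite (le_trans (lerD (ler_norm A) (lexx _))) //.
by rewrite (le_trans _ (ler_wpM2r _ (h _ zB))) ?modulus_ge0 // mulrC -ler_pdivrMr.
Qed.

(** Degree one expands by the condition on the leading coefficient, higher degree by superlinear
    growth. A single [b] gives both the rate and the radius, so that a common value for all
    generators is just a minimum. *)
Lemma horner_expands p : (1 < size p)%N ->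
    (size p = 2%N -> 1 < modulus (lead_coef p)) ->
  exists2 b : R, 0 < b &
    forall z, b^-1 <= modulus z -> (1 + b) * modulus z <= modulus p.[z].
Proof.
(* Both cases have the form p * X + c with |p| >= a > 1 far out: [a] is the modulus of the leading
   coefficient in degree one and 2 otherwise. *)
suff H : forall p (a : R), 1 < a ->
    (exists2 B : R, 0 < B & forall z, B <= modulus z -> a <= modulus p.[z]) ->
    forall c, exists2 b : R, 0 < b & forall z, b^-1 <= modulus z ->
    (1 + b) * modulus z <= modulus (p * 'X + c%:P).[z].
  move=> p1 p2; elim/poly_ind: p p1 p2 => [|p c _]; first by rewrite size_poly0.
  have [->|p0] := eqVneq p 0.
    by rewrite mul0r add0r ltnNge size_polyC_leq1.
  rewrite size_MXaddC (negPf p0) /= ltnS => sp h.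
  have [sp1|sp1] := leqP (size p) 1.
    have pE := size1_polyC sp1; apply: (H p (modulus p`_0)).
      move: h; rewrite lead_coefDl ?size_mulX // ?lead_coefMX; last first.
        by rewrite ltnS (leq_trans (size_polyC_leq1 c)).
      rewrite {2}pE lead_coefC; apply; congr _.+1.
      by apply/eqP; rewrite eqn_leq sp1.
    by exists 1 => // z _; rewrite {2}pE hornerC.
  apply: (H p 2); first by rewrite ltr1n.
  exact: horner_infinity.
move=> {}p a a1 [B B0 h] c.
(* Then a = 1 + 2b: one [b] is the rate kept, the other absorbs the constant term once |c| <=
   b|z|. *)
pose b := (a - 1) / 2.
have b0 : 0 < b by rewrite divr_gt0 // subr_gt0.
pose A := B + b^-1 + modulus c / b.
have cb : 0 <= modulus c / b by rewrite divr_ge0 ?modulus_ge0 ?ltW.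
have A0 : 0 < A by rewrite /A -addrA ltr_wpDr // addr_ge0 // invr_ge0 ltW.
exists (Num.min b A^-1); first by rewrite lt_min b0 invr_gt0.
move=> z; have [mb mA] : Num.min b A^-1 <= b /\ Num.min b A^-1 <= A^-1.
  by rewrite !ge_min !lexx orbT.
have m0 : 0 < Num.min b A^-1 by rewrite lt_min b0 invr_gt0.
have Az : A <= (Num.min b A^-1)^-1.
  by rewrite -[A in A <= _]invrK lef_pV2 ?posrE ?invr_gt0.
move=> /(le_trans Az) {}Az; rewrite !hornerE.
apply: le_trans (modulus_subl _ _); rewrite modulusM lerBrDr.
have b1 : 0 <= b^-1 by rewrite invr_ge0 ltW.
have zB : B <= modulus z by rewrite (le_trans _ Az) // /A -addrA lerDl addr_ge0.
have zc : modulus c <= b * modulus z.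
  rewrite mulrC -ler_pdivrMr // (le_trans _ Az) // /A lerDr addr_ge0 // ltW //.
rewrite (le_trans _ (ler_wpM2r _ (h _ zB))) ?modulus_ge0 //.
have z0 := modulus_ge0 z.
have : (1 + Num.min b A^-1) * modulus z <= (1 + b) * modulus z.
  by rewrite ler_wpM2r // lerD2l.
have : a = 1 + b + b by rewrite /b; field.
by move=> ->; nra.
Qed.

Lemma finite_uniform_pos (I : finType) (P : I -> R -> Prop) :
    (forall i e e', 0 < e' <= e -> P i e -> P i e') ->
    (forall i, exists2 e : R, 0 < e & P i e) ->
  exists2 e : R, 0 < e & forall i, P i e.
Proof.
move=> mono ex; have [f fP] := choice (fun i => let: ex_intro2 e e0 Pe := ex i in
  ex_intro (fun e => 0 < e /\ P i e) e (conj e0 Pe)).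
have m0 : 0 < \big[Num.min/1]_(i : I) f i.
  by elim/big_ind: _ => // [x y x0 y0|i _]; [rewrite lt_min x0 | have [] := fP i].
exists (\big[Num.min/1]_(i : I) f i) => // i.
apply: (mono i (f i)); last by have [] := fP i.
by rewrite m0 bigmin_le_cond.
Qed.

End Estimates.
(** * Normality and the Julia set *)

Lemma subsequence (P : nat -> Prop) :
  (forall n, exists2 k, (n <= k)%N & P k) ->
  exists2 phi : nat -> nat, {homo phi : j k / (j < k)%N} & forall k, P (phi k).
Proof.
move=> H; have [s sP] := choice (fun n => let: ex_intro2 k nk Pk := H n in
  ex_intro (fun k => (n <= k)%N /\ P k) k (conj nk Pk)).
exists (fun k => iter k (fun m => s m.+1) (s 0%N)); last first.
  case=> [|k] /=; first by have [] := sP 0%N.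
  by have [] := sP (iter k (fun m => s m.+1) (s 0%N)).+1.
apply: (homo_ltn ltn_trans) => k /=.
by have [] := sP (iter k (fun m => s m.+1) (s 0%N)).+1.
Qed.

Lemma pigeonhole (T : finType) (c : nat -> T) :
  exists t, forall n, exists2 k, (n <= k)%N & c k = t.
Proof.
apply: contrapT => /forallNP H.
have {}H t : exists n, forall k, (n <= k)%N -> c k != t.
  have /existsNP[n hn] := H t; exists n => k nk; apply/eqP => ckt.
  by apply: hn; exists k.
have [m mP] := choice H.
have /eqP := mP (c (\max_t m t)%N) (\max_t m t)%N (leq_bigmax _); by [].
Qed.

Section Fatou.
Variable R : realType.
Implicit Types (x y z u : R[i]) (p q : {poly R[i]}) (S : set {poly R[i]}).

Lemma chordal_refl (a : sphere R) : chordal a a = 0.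
Proof. by case: a => //= z; rewrite subrr modulus0 mulr0 mul0r. Qed.

Lemma chordal_infty z (e : R) : 0 < e -> 2 / e < modulus z ->
  chordal (Some z) None < e.
Proof.
move=> e0 h; rewrite /chordal.
have z0 : 0 < modulus z by apply: le_lt_trans h; rewrite divr_ge0 // ltW.
have hs : modulus z <= Num.sqrt (1 + modulus z ^+ 2).
  rewrite -[leLHS]ger0_norm ?modulus_ge0 // -sqrtr_sqr.
  by rewrite ler_sqrt ?lerDr ?addr_ge0 ?sqr_ge0.
rewrite ltr_pdivrMr ?(lt_le_trans z0) // (lt_le_trans _ (ler_wpM2l (ltW e0) hs)) //.
by rewrite mulrC -ltr_pdivrMr.
Qed.

(** Uniform convergence on all of [A] stands in for convergence on compact subsets; the limit may be
    infinite. Through [fatouP], small discs of the plane suffice to detect the Fatou set. *)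
Definition normal_on S (A : set R[i]) : Prop :=
  forall f : nat -> {poly R[i]}, (forall k, S (f k)) ->
  exists (phi : nat -> nat) (h : R[i] -> sphere R),
    {homo phi : j k / (j < k)%N} /\
    forall e : R, 0 < e -> exists n, forall k, (n <= k)%N ->
      forall x, A x -> chordal (Some (f (phi k)).[x]) (h x) < e.

Lemma open_disc z (r : R) : open (disc z r).
Proof.
rewrite openE => x xr; apply/nbhs_disc.
exists (r - modulus (x - z)); first by rewrite subr_gt0.
by move=> w; rewrite /disc /= ltrBrDr => /(le_lt_trans (modulusB _ _ _)).
Qed.

Lemma fatouP S z : Defs.fatou S (Some z) <->
  exists2 r : R, 0 < r & normal_on S (disc z r).
Proof.
split.
  case=> U [Uo nU] Uz.
  have [r r0 rU] : exists2 r : R, 0 < r & disc z r `<=` Some @^-1` U.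
    by apply/nbhs_some_disc; exact: (open_nbhs_nbhs (conj Uo Uz)).
  (* The square of half-side r/4 about [z] contains the disc of radius r/4 and, its points being
     within r/2 of [z], lies inside the disc of radius r. *)
  pose K : set (sphere R) := (fun x => Some (x + z)) @` square (r / 4).
  have cK : compact K.
    apply: continuous_compact; last exact: compact_square.
    apply: continuous_subspaceT => x A /nbhs_some_disc[d d0 dA].
    apply/nbhs_disc; exists d => // w wx; apply: dA.
    by rewrite /disc /= opprD addrACA subrr addr0.
  have KU : K `<=` U.
    move=> _ [x /square_modulus_le xr <-]; apply: rU; rewrite /disc /= addrK.
    by rewrite (le_lt_trans xr) // mulrA ltr_pdivrMr // mulrC ltr_pM2l // ltr_nat.
  exists (r / 4); first by rewrite divr_gt0.
  move=> f Sf; have [k|phi [h [phiP hP]]] := nU (fun k => sphere_map (f k)).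
    by exists (f k).
  exists phi, (fun x => h (Some x)); split=> // e e0.
  have [n _ nP] := hP _ cK KU e e0; exists n => k nk x xr.
  apply: (nP k nk (Some x)); exists (x - z); last by rewrite subrK.
  by apply: modulus_le_square; exact: ltW.
case=> r r0 nr; exists (Some @` disc z r); last first.
  by exists z => //; rewrite /disc /= subrr modulus0.
split; first by apply: one_point_compactification_open_some; exact: open_disc.
move=> F SF; have [f fP] := choice (fun k => let: ex_intro2 p Sp pE := SF k in
  ex_intro (fun p => S p /\ sphere_map p = F k) p (conj Sp pE)).
have [phi [h [phiP hP]]] := nr f (fun k => (fP k).1).
exists phi, (fun a => if a is Some x then h x else None); split=> // K _ KU e e0.
have [n nP] := hP e e0; exists n => // k nk a /KU[x xr <-].
by have [_ <-] := fP (phi k); exact: nP.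
Qed.

Lemma normal_onS S (A B : set R[i]) : A `<=` B -> normal_on S B -> normal_on S A.
Proof.
move=> AB nB f Sf; have [phi [h [phiP hP]]] := nB f Sf.
exists phi, h; split=> // e e0; have [n nP] := hP e e0.
by exists n => k nk x /AB; exact: nP.
Qed.

Lemma julia_closed S : closed [set z : R[i] | julia S (Some z)].
Proof.
apply: (@open_closedC _ [set z : R[i] | Defs.fatou S (Some z)]).
rewrite openE => x /fatouP[r r0 nr]; apply/nbhs_disc; exists r => // w wr.
apply/fatouP; exists (r - modulus (w - x)); first by rewrite subr_gt0.
apply: normal_onS nr => v; rewrite /disc /= ltrBrDr.
exact/le_lt_trans/modulusB.
Qed.

Lemma compact_bounded_closed (A : set R[i]) (B : R) :
  closed A -> (forall z, A z -> modulus z <= B) -> compact A.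
Proof.
move=> cA AB; apply: (subclosed_compact cA (@compact_square R B)).
by move=> z /AB /modulus_le_square.
Qed.

(* Polynomials are open maps, so a limit on a small disc around [x] of
   [f_k \o p] gives a limit of [f_k] around [p.[x]]. *)
Lemma julia_backward S p x : (1 < size p)%N ->
  (forall q, S q -> S (q \Po p)) ->
  julia S (Some p.[x]) -> julia S (Some x).
Proof.
move=> p1 Sp; apply: contra_not => /fatouP[r r0 nr]; apply/fatouP.
have [d d0 dP] := horner_open x p1 r0; exists d => // f Sf.
have [phi [h [phiP hP]]] := nr (fun k => f k \Po p) (fun k => Sp _ (Sf k)).
(* A pointwise section of [p], with 0 as default off the disc; uniform convergence passes through it
   without any continuity. *)
have /choice[s sP] : forall w, exists v,
    disc p.[x] d w -> disc x r v /\ p.[v] = w.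
  move=> w; have [/dP[v xv pv]|nw] := pselect (disc p.[x] d w); first by exists v.
  by exists 0.
exists phi, (fun w => h (s w)); split=> // e e0.
have [n nP] := hP e e0; exists n => k nk w /sP[xsw psw].
by rewrite -{1}psw -horner_comp; exact: nP.
Qed.

End Fatou.
(** * Dynamics of words *)

Lemma exprn_unbounded (R : archiRealFieldType) (A a : R) : 1 < a ->
  exists n, A < a ^+ n.
Proof.
move=> a1; have bern n : 1 + n%:R * (a - 1) <= a ^+ n.
  elim: n => [|n IH]; first by rewrite mul0r addr0.
  have a0 : 0 <= a - 1 by rewrite subr_ge0 ltW.
  have n0 : 0 <= n%:R * (a - 1) by rewrite mulr_ge0.
  rewrite exprS -natr1; apply: (@le_trans _ _ (a * (1 + n%:R * (a - 1)))).
    by nra.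
  by rewrite ler_wpM2l // (le_trans ler01) // ltW.
exists (Num.bound `|A / (a - 1)|); apply: lt_le_trans (bern _).
have a0 : 0 < a - 1 by rewrite subr_gt0.
rewrite ltr_wpDl // -ltr_pdivrMr //.
exact: le_lt_trans (ler_norm _) (archi_boundP (normr_ge0 _)).
Qed.

Section Words.
Variables (R : realType) (N : nat) (g : 'I_N -> {poly R[i]}).
Hypothesis g_gt1 : forall i, (1 < size (g i))%N.
Let S := generated_semigroup g.

Lemma word_poly_cons i w : word_poly g (i :: w) = word_poly g w \Po g i.
Proof.
rewrite /word_poly /= comp_polyXr; elim/last_ind: w => [|w j IH] /=.
  by rewrite comp_polyX.
by rewrite !foldl_rcons IH comp_polyA.
Qed.

Lemma size_word_poly w : (1 < size (word_poly g w))%N.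
Proof.
elim: w => [|i w IH]; first by rewrite size_polyX.
by rewrite word_poly_cons size_comp_gt1.
Qed.

Lemma generated_semigroup_comp i q : S q -> S (q \Po g i).
Proof. by case=> w _ ->; exists (i :: w); rewrite ?word_poly_cons. Qed.

Lemma julia_generator i x : julia S (Some (g i).[x]) -> julia S (Some x).
Proof.
by apply: julia_backward => // q; exact: generated_semigroup_comp.
Qed.

Lemma julia_word w x : julia S (Some (word_poly g w).[x]) -> julia S (Some x).
Proof.
elim: w x => [|i w IH] x; first by rewrite hornerX.
by rewrite word_poly_cons horner_comp => /IH /julia_generator.
Qed.

(* The first letters of the words of a sequence in [S] are constant along a
   subsequence. *)
Lemma julia_forward x : julia S (Some x) -> exists i, julia S (Some (g i).[x]).
Proof.
move=> Jx; apply: contrapT => /forallNP H; apply: Jx.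
have {}H i : exists2 r : R, 0 < r & normal_on S (disc (g i).[x] r).
  by apply/fatouP; apply: contrapT; exact: H.
have [r r0 rP] : exists2 r : R, 0 < r & forall i, exists2 e,
    normal_on S (disc (g i).[x] e) & forall z, disc x r z -> disc (g i).[x] e (g i).[z].
  apply: finite_uniform_pos => [i e e' /andP[e'0 ee'] [d nd dP]|i].
    exists d => // z; rewrite /disc /= => /lt_le_trans-/(_ _ ee'); exact: dP.
  have [d d0 nd] := H i; have [e e0 eP] := horner_near (g i) x d0.
  by exists e => //; exists d.
apply/fatouP; exists r => // f Sf.
have [w wP] := choice (fun k => let: ex_intro2 v v0 fE := Sf k in
  ex_intro (fun v => v != [::] /\ f k = word_poly g v) v (conj v0 fE)).
have N0 : (0 < N)%N.
  have [+ _] := wP 0%N; case: (w 0%N) => // -[i iN] _ _.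
  exact: leq_ltn_trans iN.
(* [Ordinal N0] is only the default of [head]: the words chosen here are nonempty. *)
have [i iP] := pigeonhole (fun k => head (Ordinal N0) (w k)).
have [phi phiP phii] := subsequence iP.
have fE k : f (phi k) = word_poly g (behead (w (phi k))) \Po g i.
  have [+ ->] := wP (phi k); rewrite -(phii k).
  by case: (w (phi k)) => // j v _; rewrite word_poly_cons.
(* Either the word is the single letter [i] infinitely often, and that subsequence is constant, or
   the remaining words are eventually nonempty and normality near the image of [x] under [g i]
   applies to them. *)
have [nil|nnil] := pselect (forall n, exists2 k, (n <= k)%N & behead (w (phi k)) = [::]).
  have [psi psiP psin] := subsequence nil.
  exists (phi \o psi), (fun z => Some (g i).[z]); split.
    by move=> j k /psiP /phiP.
  move=> e e0; exists 0%N => k _ z _.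
  by rewrite [(phi \o psi) k]/= fE psin [word_poly _ _]/= comp_polyX chordal_refl.
have [n nP] : exists n, forall k, (n <= k)%N -> behead (w (phi k)) != [::].
  apply: contrapT => /forallNP h; apply: nnil => n; have /existsNP[k] := h n.
  by move=> /not_implyP[nk /negP]; rewrite negbK => /eqP; exists k.
have [d nd dP] := rP i.
have [k|psi [h [psiP hP]]] := nd (fun k => word_poly g (behead (w (phi (n + k)%N)))).
  by exists (behead (w (phi (n + k)%N))) => //; exact/nP/leq_addr.
exists (fun k => phi (n + psi k)%N), (fun z => h (g i).[z]); split.
  by move=> j k /psiP jk; apply: phiP; rewrite ltn_add2l.
move=> e e0; have [m mP] := hP e e0; exists m => k mk z /dP zd.
by rewrite fE horner_comp; exact: mP.
Qed.

Lemma word_poly_escape (b : R) : 0 < b ->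
    (forall i z, b^-1 <= modulus z -> (1 + b) * modulus z <= modulus (g i).[z]) ->
  forall w z, b^-1 <= modulus z ->
    (1 + b) ^+ size w * modulus z <= modulus (word_poly g w).[z].
Proof.
move=> b0 H; elim=> [|i w IH] z bz; first by rewrite hornerX mul1r.
rewrite word_poly_cons horner_comp /= exprSr -mulrA.
have h := H i _ bz; apply: (@le_trans _ _ ((1 + b) ^+ size w * modulus (g i).[z])).
  by rewrite ler_wpM2l // exprn_ge0 // addr_ge0 // ltW.
apply: IH; apply: le_trans bz _; apply: le_trans h.
by rewrite ler_peMl ?modulus_ge0 // lerDl ltW.
Qed.

(** Beyond radius 1/b words escape geometrically in their length. On a disc out there a sequence in
    [S] has a constant subsequence, when words of bounded length recur, or else tends uniformly to
    infinity. *)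
Lemma julia_bounded :
    (forall i, size (g i) = 2%N -> 1 < modulus (lead_coef (g i))) ->
  exists B : R, forall x, julia S (Some x) -> modulus x <= B.
Proof.
move=> g2.
have [b b0 bP] : exists2 b : R, 0 < b & forall i z, b^-1 <= modulus z ->
    (1 + b) * modulus z <= modulus (g i).[z].
  apply: finite_uniform_pos => [i e e' /andP[e'0 ee'] h z zb|i].
    have ez : e^-1 <= modulus z.
      by rewrite (le_trans _ zb) // lef_pV2 // posrE (lt_le_trans e'0).
    by apply: le_trans (h z ez); rewrite ler_wpM2r ?modulus_ge0 // lerD2l.
  exact: horner_expands (g_gt1 i) (g2 i).
exists b^-1 => x Jx; rewrite leNgt; apply/negP => bx; apply: Jx; apply/fatouP.
exists (modulus x - b^-1); first by rewrite subr_gt0.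
have escape w z : disc x (modulus x - b^-1) z ->
    (1 + b) ^+ size w * b^-1 <= modulus (word_poly g w).[z].
  rewrite /disc /= => zx.
  have bz : b^-1 <= modulus z.
    by have := modulus_subl x (z - x); rewrite subrKC; lra.
  apply: le_trans (word_poly_escape b0 bP w bz).
  by rewrite ler_wpM2l // exprn_ge0 // addr_ge0 // ltW.
move=> f Sf.
have [w wP] := choice (fun k => let: ex_intro2 v v0 fE := Sf k in
  ex_intro (fun v => v != [::] /\ f k = word_poly g v) v (conj v0 fE)).
have [[L LP]|nL] := pselect
    (exists L, forall n, exists2 k, (n <= k)%N & (size (w k) <= L)%N).
  have [phi phiP phiL] := subsequence LP.
  have [v vP] := pigeonhole (fun k => insub_bseq L (w (phi k))).
  have [psi psiP psiv] := subsequence vP.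
  exists (phi \o psi), (fun z => Some (word_poly g v).[z]); split.
    by move=> j k /psiP /phiP.
  move=> e e0; exists 0%N => k _ z _.
  rewrite [(phi \o psi) k]/= -(psiv k) insubdK ?(wP _).2 ?chordal_refl //.
  exact: phiL.
exists id, (fun=> None); split=> // e e0.
have [L LP] : exists L, 2 / e < (1 + b) ^+ L * b^-1.
  have b1 : 1 < 1 + b by rewrite ltrDl.
  have [L LP] := exprn_unbounded (2 / e * b) b1.
  by exists L; rewrite ltr_pdivlMr.
have [n nP] : exists n, forall k, (n <= k)%N -> (L < size (w k))%N.
  apply: contrapT => /forallNP h; apply: nL; exists L => n.
  have /existsNP[k /not_implyP[nk /negP]] := h n; rewrite -leqNgt.
  by exists k.
exists n => k nk z /(escape (w k)) kz; rewrite (wP k).2.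
apply: chordal_infty => //; apply: lt_le_trans LP _; apply: le_trans kz.
rewrite ler_wpM2r ?invr_ge0 ?(ltW b0) // ler_weXn2l ?lerDl ?(ltW b0) //.
exact: ltnW (nP _ nk).
Qed.

End Words.
(** * Lower bound on the maximal derivative *)

Section MaxDerivative.
Variables (R : realType) (N : nat) (g : 'I_N -> {poly R[i]}).
Hypothesis g_gt1 : forall i, (1 < size (g i))%N.
Hypothesis g_lead : forall i, size (g i) = 2%N -> 1 < modulus (lead_coef (g i)).
Let S := generated_semigroup g.
Let M := max_derivative S g.

(** A [sup] bounds its set only when the set is bounded; boundedness of the Julia set provides
    this. *)
Lemma max_derivative_ub i x : julia S (Some x) -> modulus (g i)^`().[x] <= M.
Proof.
move=> Jx; have [B BP] := julia_bounded g_gt1 g_lead.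
have [C CP] := choice (fun i => let: ex_intro2 c _ cP := horner_bounded (g i)^`() B in
  ex_intro (fun c => forall z, modulus z <= B -> modulus (g i)^`().[z] <= c) c cP).
apply: ub_le_sup; last by exists i, x.
exists (\big[Num.max/0]_j C j) => _ [j [z [/BP zB ->]]].
by apply: (le_trans (CP _ _ zB)); exact: le_bigmax_cond.
Qed.

(** Some letter keeps the orbit in the Julia set at each step, so the chain rule yields one factor
    at most [M] per letter. *)
Lemma julia_itinerary n x : julia S (Some x) ->
  exists w : seq 'I_N, [/\ size w = n, julia S (Some (word_poly g w).[x]) &
    modulus (word_poly g w)^`().[x] <= M ^+ n].
Proof.
elim: n x => [|n IH] x Jx.
  exists [::]; split=> //; rewrite ?hornerX //.
  by rewrite derivX hornerC modulus1 expr0.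
have [i Ji] := julia_forward Jx; have [w [wn Jw Mw]] := IH _ Ji.
exists (i :: w); rewrite word_poly_cons horner_comp /= wn; split=> //.
rewrite deriv_comp hornerM horner_comp modulusM exprSr.
by rewrite ler_pM ?modulus_ge0 // max_derivative_ub.
Qed.

Lemma degree_word_poly w :
  (size (word_poly g w)).-1 = (\prod_(i <- w) (size (g i)).-1)%N.
Proof.
elim: w => [|i w IH]; first by rewrite size_polyX big_nil.
by rewrite word_poly_cons size_comp_poly IH big_cons mulnC.
Qed.

(* If [y] were the only point of the Julia set, Gauss-Lucas would put all
   critical points at [y]. *)
Lemma julia_two_points y c1 c2 : critical_points g c1 -> critical_points g c2 ->
  c1 != c2 -> julia S (Some y) -> exists2 y', y' != y & julia S (Some y').
Proof.
move=> crit1 crit2 c12 Jy; apply: contrapT => nex.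
have Jy1 x : julia S (Some x) -> x = y.
  by move=> Jx; apply: contrapT => /eqP xy; apply: nex; exists x.
suff crit c : critical_points g c -> c = y.
  by rewrite (crit _ crit1) (crit _ crit2) eqxx in c12.
case=> i gc; apply/eqP; rewrite -subr_eq0 -modulus_eq0; apply/eqP/le_anti.
rewrite modulus_ge0 andbT leNgt; apply/negP => r0.
suff : disc y (modulus (c - y)) c by rewrite /disc /= ltxx.
apply: (critical_point_disc (u := y) (g_gt1 i)) => // x.
rewrite mem_fiber // => /eqP gx; rewrite (Jy1 x); last first.
  by apply: (julia_generator g_gt1 (i := i)); rewrite gx.
by rewrite /disc /= subrr modulus0.
Qed.

Lemma julia_outermost y : julia S (Some y) ->
  exists2 a, julia S (Some a) & forall x, julia S (Some x) -> modulus x <= modulus a.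
Proof.
move=> Jy; have [B BP] := julia_bounded g_gt1 g_lead.
have cJ := compact_bounded_closed (@julia_closed R S) BP.
have [||a aJ aP] := compact_EVT_max _ cJ (f := @modulus R).
- by exists y.
- exact/continuous_subspaceT/modulus_continuous.
exists a => [|x Jx]; first exact: set_mem aJ.
by apply: aP; exact: mem_set.
Qed.

(* At a point [a] of the Julia set of largest modulus, with [f] a word such
   that [f.[a]] is in the Julia set, [f^`().[a] / (f.[a] - v)] is the sum over
   the fibre of [v] of [(a - x)^-1], and each term of [a / (a - x)] has real
   part at least 1/2. So [f^`().[a]] grows like the degree of [f]. *)
Lemma max_derivative_gt1 y c1 c2 : critical_points g c1 -> critical_points g c2 ->
  c1 != c2 -> julia S (Some y) -> 1 < M.
Proof.
(* An affine generator has constant derivative, of modulus above 1; otherwise all degrees are at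
   least 2 and a word of length [n] has degree at least 2^n. *)
move=> crit1 crit2 c12 Jy; have [[i gi2]|n2] := pselect (exists i, size (g i) = 2%N).
  apply: (lt_le_trans (g_lead gi2)); apply: le_trans (max_derivative_ub i Jy).
  have /size1_polyC -> : (size (g i)^`() <= 1)%N.
    by rewrite -ltnS -gi2 lt_size_deriv // -size_poly_gt0 gi2.
  by rewrite hornerC coef_deriv lead_coefE gi2.
have [y' yy' Jy'] := julia_two_points crit1 crit2 c12 Jy.
have [a Ja aP] := julia_outermost Jy.
(* Half the distance: any value f(a) is at least [c] away from [y] or from [y']. *)
pose c := modulus (y' - y) / 2.
have c0 : 0 < c by rewrite divr_gt0 // modulus_gt0 subr_eq0.
rewrite ltNge; apply/negP => M1.
(* If M <= 1 then |f'(a)| <= 1 for suitable words of every length, whereas the fibre sum bounds |a|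
   |f'(a)| below by c 2^n / 2. *)
suff H n : 2 ^+ n * c / 2 <= modulus a.
  have [n] := exprn_unbounded (modulus a * 2 / c) (ltr1n R 2).
  rewrite ltr_pdivrMr // -ltr_pdivlMr //; apply/negP; rewrite -leNgt; exact: H.
have [w [wn Jw Mw]] := julia_itinerary n Ja.
set f := word_poly g w in Jw Mw.
have [v Jv fv] : exists2 v, julia S (Some v) & c <= modulus (f.[a] - v).
  have [h|h] := leP c (modulus (f.[a] - y)); first by exists y.
  exists y' => //; have := modulusB y' f.[a] y; rewrite (modulusC f.[a] y').
  by rewrite /c in h *; lra.
have f1 : (1 < size f)%N := size_word_poly g_gt1 w.
have fav : f.[a] != v.
  by apply/eqP => e; move: fv; rewrite e subrr modulus0 leNgt c0.
have /Re_sum_div_sub : forall x, x \in fiber f v -> x != a /\ modulus x <= modulus a.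
  move=> x; rewrite mem_fiber // => /eqP fx; split.
    by apply: contraNneq fav => <-; rewrite fx.
  by apply: aP; apply: (julia_word g_gt1 (w := w)); rewrite -/f fx.
rewrite size_fiber // => /le_trans -/(_ _ (Re_le_modulus _)).
rewrite modulusM => h.
have f'1 : modulus f^`().[a] <= 1.
  have [i _] := julia_forward Ja.
  have M0 : 0 <= M := le_trans (modulus_ge0 _) (max_derivative_ub i Ja).
  by rewrite (le_trans Mw) // exprn_ile1.
have fd : (2 : R) ^+ n <= (size f).-1%:R.
  rewrite degree_word_poly // -wn -natrX ler_nat.
  elim: (w) => [|i s IH]; first by rewrite big_nil.
  rewrite big_cons /= expnS leq_mul //.
  have := g_gt1 i; case E : (size (g i)) => [|[|[|k]]] // _.
  by case: n2; exists i.
move: f'1; rewrite (deriv_fiber f1 fav) modulusM.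
move: h fv; set s := modulus (\sum_(_ <- _) _); set e := modulus (f.[a] - v).
have s0 : 0 <= s := modulus_ge0 _.
have a0 : 0 <= modulus a := modulus_ge0 _.
move=> h ce es.
have : c * s <= 1 by apply: le_trans es; rewrite ler_wpM2r.
move=> /(ler_wpM2l a0) h1.
have : (2 ^+ n / 2) * c <= (modulus a * s) * c.
  by rewrite ler_wpM2r ?(ltW c0) // (le_trans _ h) // ler_wpM2r.
by lra.
Qed.

End MaxDerivative.
(** * Counting preimages *)

Section Counting.
Variables (R : realType) (N : nat) (g : 'I_N -> {poly R[i]}).
Hypothesis g_gt1 : forall i, (1 < size (g i))%N.
Hypothesis g_lead : forall i, size (g i) = 2%N -> 1 < modulus (lead_coef (g i)).
Let S := generated_semigroup g.
Let M := max_derivative S g.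

(** By Taylor, |g(x) - g(z)| is at most (|g'(z)| + C|x - z|) |x - z|, and |g'(z)| <= M + L|a - z|;
    since M > 1, the gap M^2 - M absorbs both errors at small radius. *)
Lemma lipschitz_near_julia : 1 < M -> exists2 r : R, 0 < r &
  forall i z a x, julia S (Some a) -> disc z r a -> disc z r x ->
    modulus ((g i).[x] - (g i).[z]) <= M ^+ 2 * modulus (x - z).
Proof.
move=> M1; have [B BP] := julia_bounded g_gt1 g_lead.
apply: finite_uniform_pos => [i e e' /andP[e'0 ee'] H z a x Ja|i].
  by move=> /lt_le_trans-/(_ _ ee') za /lt_le_trans-/(_ _ ee') zx; exact: H za zx.
(* With radius at most 1, [z] is within 1 of the Julia set and [x] within 2. *)
have [C C0 CP] := horner_taylor (g i) (B + 2).
have [L L0 LP] := horner_lipschitz (g i)^`() (B + 2).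
have M2 : 0 < M ^+ 2 - M by rewrite expr2; nra.
exists (Num.min 1 ((M ^+ 2 - M) / (C + L + 1))).
  by rewrite lt_min ltr01 divr_gt0 // ltr_wpDl // addr_ge0.
move=> z a x Ja; rewrite /disc /= !lt_min => /andP[az1 aze] /andP[xz1 xze].
have aB := BP _ Ja.
have zB : modulus z <= B + 1.
  by have := modulus_subl z (a - z); rewrite subrKC; lra.
have xB : modulus x <= B + 2.
  by have := modulus_subl x (z - x); rewrite subrKC modulusC; lra.
have zB2 : modulus z <= B + 2 by lra.
have aB2 : modulus a <= B + 2 by lra.
have h1 := CP _ _ xB zB2; have h2 := LP _ _ zB2 aB2.
have h3 := max_derivative_ub g_gt1 g_lead i Ja.
have h4 : modulus (g i)^`().[z] <= M + L * modulus (a - z).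
  rewrite -(subrK (g i)^`().[a] (g i)^`().[z]) (le_trans (modulusD _ _)) //.
  by rewrite addrC lerD // (le_trans h2) // modulusC.
rewrite -(subrK ((g i)^`().[z] * (x - z)) (_ - (g i).[z])).
rewrite (le_trans (modulusD _ _)) // modulusM.
have CL0 : 0 < C + L + 1 by lra.
rewrite ltr_pdivlMr // in aze; rewrite ltr_pdivlMr // in xze.
move: (modulus_ge0 (x - z)) (modulus_ge0 (a - z)) h1 h4 aze xze.
set s := modulus (x - z); set t := modulus (a - z).
move=> s0 t0 h1 h4 aze xze.
have [u [su tu uM]] : exists u, [/\ s <= u, t <= u & u * (C + L + 1) <= M ^+ 2 - M].
  exists (Num.max s t); rewrite !le_max !lexx orbT; split=> //.
  by case: (leP s t) => _; exact: ltW.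
rewrite (le_trans (lerD h1 (ler_wpM2r s0 h4))) //.
rewrite expr2 mulrA -mulrDl ler_wpM2r //.
have hC : C * s <= C * u by rewrite ler_wpM2l.
have hL : L * t <= L * u by rewrite ler_wpM2l.
have u0 : 0 <= u by lra.
by lra.
Qed.

(* By Gauss-Lucas, a disc containing a whole fibre of every generator contains
   all critical points. *)
Lemma fiber_not_in_small_disc c1 c2 z (r : R) :
  critical_points g c1 -> critical_points g c2 -> 2 * r <= modulus (c1 - c2) ->
  exists i, forall u,
    (count (fun x => x \in disc z r) (fiber (g i) u) < (size (g i)).-1)%N.
Proof.
move=> crit1 crit2 rc; apply: contrapT => /forallNP H.
suff crit c : critical_points g c -> disc z r c.
  have := crit _ crit1; have := crit _ crit2; rewrite /disc /= => h2 h1.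
  by have := modulusB c1 z c2; rewrite (modulusC z c2); lra.
case=> i gc; have /existsNP[u /negP] := H i; rewrite -leqNgt => hu.
apply: (critical_point_disc (u := u) (g_gt1 i)) => // x xu.
have /allP/(_ _ xu) : all (fun x => x \in disc z r) (fiber (g i) u).
  by rewrite all_count eqn_leq count_size size_fiber.
exact: set_mem.
Qed.

(** Arbitrary sets let one recursion serve both small discs and the whole plane. *)
Definition preimage_count_in n (y : R[i]) (A : set R[i]) : nat :=
  (\sum_(w : n.-tuple 'I_N) count (fun x => x \in A) (fiber (word_poly g w) y))%N.

Lemma preimage_count_disc n y z (r : R) :
  preimage_count g n y z r = preimage_count_in n y (disc z r).
Proof.
by apply: eq_bigr => w _; rewrite sum_ord_at // size_word_poly.
Qed.

Lemma preimage_count_in0 y (A : set R[i]) : (preimage_count_in 0 y A <= 1)%N.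
Proof.
rewrite /preimage_count_in (bigD1 [tuple]) //= big1 => [|w]; last by rewrite tuple0.
by rewrite addn0 (leq_trans (count_size _ _)) // size_fiber size_polyX.
Qed.

(** Splitting off the first letter [i]: a point of [A] counted for [i :: w] is sent by [g i] into
    the part of the fibre of [w] inside [B i], and over each such point at most [m i] are
    counted. *)
Lemma preimage_count_inS n y (A : set R[i]) (B : 'I_N -> set R[i]) (m : 'I_N -> nat) :
    (forall i u, (count (fun x => x \in A) (fiber (g i) u) <= m i)%N) ->
    (forall i x, A x -> B i (g i).[x]) ->
  (preimage_count_in n.+1 y A <= \sum_i m i * preimage_count_in n y (B i))%N.
Proof.
move=> mP BP; rewrite /preimage_count_in.
rewrite (reindex (fun p : 'I_N * n.-tuple 'I_N => [tuple of p.1 :: p.2])) /=; last first.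
  exists (fun w : n.+1.-tuple 'I_N => (thead w, [tuple of behead w])) => [[i w] _|w _] /=.
    by rewrite theadE; congr (i, _); exact: val_inj.
  by apply: val_inj => /=; case/tupleP: w.
rewrite -(pair_bigA _ (fun i w =>
  count (fun x => x \in A) (fiber (word_poly g (i :: tval w)) y))) /=.
apply: leq_sum => i _; rewrite big_distrr /=; apply: leq_sum => w _.
rewrite word_poly_cons (permP (fiber_comp _ _ _)) ?size_word_poly //.
elim: (fiber _ y) => [|u s IH] /=; first by rewrite muln0.
rewrite count_cat mulnDr leq_add //.
have [_|uB] := boolP (u \in B i); first by rewrite muln1.
rewrite muln0 leqn0 -leqn0 leqNgt -has_count; apply/negP => /hasP[x].
rewrite mem_fiber // => /eqP gx xA; case/negP: uB.
by rewrite -gx; apply/mem_set/BP/set_mem.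
Qed.

Lemma preimage_count_in_le n y (A : set R[i]) :
  (preimage_count_in n y A <= degree_sum g ^ n)%N.
Proof.
elim: n A => [|n IH] A; first exact: preimage_count_in0.
have := @preimage_count_inS n y A (fun=> setT) (fun i => (size (g i)).-1).
move=> /(_ _ (fun _ _ _ => I)) h; rewrite expnS /degree_sum big_distrl /=.
apply: leq_trans (h _) _ => [i u|]; last by apply: leq_sum => i _; rewrite leq_mul.
by rewrite -(size_fiber u (g_gt1 i)) count_size.
Qed.

Lemma preimage_count_in_julia n y (A : set R[i]) : julia S (Some y) ->
  (forall x, A x -> ~ julia S (Some x)) -> preimage_count_in n y A = 0%N.
Proof.
move=> Jy AJ; apply: big1 => w _; apply/eqP; rewrite -leqn0 leqNgt -has_count.
apply/negP => /hasP[x]; rewrite mem_fiber ?size_word_poly // => /eqP wx /set_mem /AJ.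
by apply; apply: (julia_word g_gt1 (w := w)); rewrite wx.
Qed.

(** Peeling first letters: while the radius is at most [r0], one generator loses a preimage, so the
    step costs D - 1 instead of D, and the radius grows by the factor [q]. The hypothesis on r q^k
    grants [nu] such steps; after them the crude bound by powers of D takes over. *)
Lemma preimage_count_in_small (r0 q : R) y n nu z r : julia S (Some y) ->
    (forall i z a x, julia S (Some a) -> disc z r0 a -> disc z r0 x ->
      modulus ((g i).[x] - (g i).[z]) <= q * modulus (x - z)) ->
    (forall z, exists i, forall u,
      (count (fun x => x \in disc z r0) (fiber (g i) u) < (size (g i)).-1)%N) ->
    0 < q -> (forall k, (k < nu)%N -> r * q ^+ k <= r0) ->
  (preimage_count_in n y (disc z r)
   <= (degree_sum g).-1 ^ minn n nu * degree_sum g ^ (n - minn n nu))%N.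
Proof.
move=> Jy lip fan q0; elim: n nu z r => [|n IH] [|nu] z r rq.
- exact: preimage_count_in0.
- exact: preimage_count_in0.
- by rewrite minn0 subn0 mul1n preimage_count_in_le.
have rr0 : r <= r0 by have := rq 0%N isT; rewrite mulr1.
have sub w x : disc w r x -> disc w r0 x by move=> h; exact: lt_le_trans h rr0.
(* The expansion estimate needs a point of the Julia set in the disc; a disc without one contains no
   preimage of [y]. *)
have [[a az Ja]|noJ] := pselect (exists2 a, disc z r a & julia S (Some a)); last first.
  by rewrite preimage_count_in_julia // => x zx Jx; apply: noJ; exists x.
have [i0 i0P] := fan z.
pose m i := ((size (g i)).-1 - (i == i0))%N.
have cr0 i u : (count (fun x => x \in disc z r) (fiber (g i) u)
                <= count (fun x => x \in disc z r0) (fiber (g i) u))%N.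
  by apply: sub_count => x /set_mem /sub /mem_set.
have h := @preimage_count_inS n y (disc z r) (fun i => disc (g i).[z] (r * q)) m.
apply: leq_trans (h _ _) _.
- move=> i u; apply: leq_trans (cr0 i u) _; rewrite /m.
  have [->|_] := eqVneq i i0.
    by have := i0P u; case: (size (g i0)).-1 => // k; rewrite ltnS subn1.
  by rewrite subn0 -(size_fiber u (g_gt1 i)) count_size.
- move=> i x zx; rewrite /disc /=.
  apply: le_lt_trans (lip i z a x Ja (sub _ _ az) (sub _ _ zx)) _.
  by rewrite mulrC ltr_pM2r.
have mD : (\sum_i m i)%N = (degree_sum g).-1.
  rewrite /degree_sum (bigD1 i0) //= [RHS](congr1 predn (bigD1 i0 _)) //= /m eqxx subn1.
  rewrite [X in (_ + X = _)%N](eq_bigr (fun i => (size (g i)).-1)); last first.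
    by move=> i /negPf ->; rewrite subn0.
  (* The strict bound makes the degree of [g i0] positive, so the truncated subtraction of 1 passes
     through the sum. *)
  by have := i0P 0; case: (size (g i0)).-1.
rewrite minnSS subSS expnS -mulnA -{1}mD big_distrl /=.
apply: leq_sum => i _; rewrite leq_mul2l; apply/orP; right.
by apply: IH => k knu; rewrite -mulrA -exprS rq.
Qed.

End Counting.
(** * Scales and the final estimate *)

Lemma degree_sum_gt (R : realType) (N : nat) (g : 'I_N -> {poly R[i]}) :
    (forall i, (1 < size (g i))%N) -> (exists i, (2 < size (g i))%N) ->
  (N < degree_sum g)%N.
Proof.
move=> g1 [i0 gi0]; rewrite /degree_sum -[X in (X < _)%N]card_ord -sum1_card.
rewrite (bigD1 i0) //= [ltnRHS](bigD1 i0) //= -addSn leq_add //.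
  by rewrite -ltnS prednK // ltnW // g1.
by apply: leq_sum => i _; rewrite -ltnS prednK ?g1 // ltnW.
Qed.

(** Since rho^(1/lambda) = M, the intervals I(nu) shrink by M^2 per step, the very Lipschitz
    constant found near the Julia set. *)
Lemma powR_scale (R : realType) (rho M : R) (t : R) : 1 < rho -> 1 < M ->
  rho `^ (- (2 * t / (ln rho / ln M))) = (M ^+ 2) `^ (- t).
Proof.
move=> rho1 M1; have M0 : 0 < M by rewrite (lt_trans ltr01).
rewrite /powR !gt_eqF ?exprn_gt0 ?(lt_trans ltr01 rho1) //.
congr expR; rewrite lnXn // mulr2n; have := ln_gt0 rho1; have := ln_gt0 M1.
by move=> l1 l2; field; rewrite !gt_eqF.
Qed.

(** The index is the least [mu] with r q^mu > r0; it is positive as r <= r0, and its minimality is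
    what keeps the discs small before it. *)
Lemma scale_index (R : realType) (r0 q r : R) : 1 < q -> 0 < r <= r0 ->
  exists nu : nat, unique (fun mu : nat => (0 < mu)%N /\
    r0 * q `^ (- mu%:R) < r <= r0 * q `^ (- (mu%:R - 1))) nu /\
    forall k, (k < nu)%N -> r * q ^+ k <= r0.
Proof.
move=> q1 /andP[rgt0 rr0]; have q0 : 0 < q by rewrite (lt_trans ltr01).
have P1 mu : (r0 * q `^ (- mu%:R) < r) = (r0 < r * q ^+ mu).
  by rewrite powRN powR_mulrn ?(ltW q0) // ltr_pdivrMr ?exprn_gt0.
have P2 mu : (r <= r0 * q `^ (- (mu.+1%:R - 1))) = (r * q ^+ mu <= r0).
  by rewrite -natr1 addrK powRN powR_mulrn ?(ltW q0) // ler_pdivlMr ?exprn_gt0.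
have [n nP] := exprn_unbounded (r0 / r) q1.
have ex : exists n, r0 < r * q ^+ n by exists n; rewrite mulrC -ltr_pdivrMr.
case: (ex_minnP ex) => -[|nu] nuP nuM; first by move: nuP; rewrite mulr1 ltNge rr0.
have small k : (k < nu.+1)%N -> r * q ^+ k <= r0.
  by move=> knu; rewrite leNgt; apply/negP => /nuM; rewrite leqNgt knu.
exists nu.+1; split=> //; split; first by rewrite P1 P2 nuP small.
case=> [|mu] [] // _; rewrite P1 P2 => /andP[h1 h2].
apply/eqP; rewrite eqn_leq nuM //= ltnNge; apply/negP => h.
move: h2; apply/negP; rewrite -ltNge (lt_le_trans nuP) //.
by rewrite ler_pM2l // ler_weXn2l // ltW.
Qed.

(** For n <= nu the product is (d - 1)^n. Otherwise it is d^n ((d - 1)/d)^nu, and the condition on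
    [kappa] makes ((d - 1)/d)^nu at most (N/d)^(nu/kappa); the remaining factor d/N >= 1 is
    slack. *)
Lemma count_bound (R : realType) (N d kappa n nu : nat) : (0 < N)%N -> (N < d)%N ->
    (0 < kappa)%N -> (d%:R / N%:R : R) <= (d%:R / d.-1%:R) ^+ kappa ->
  (d.-1 ^ minn n nu * d ^ (n - minn n nu))%:R <=
  Num.max (d%:R `^ (n%:R - nu%:R / kappa%:R + 1) * N%:R `^ (nu%:R / kappa%:R - 1))
          ((d%:R - 1 / 2) ^+ n : R).
Proof.
move=> N0 Nd k0 hk; rewrite le_max.
have d1 : (0 < d.-1)%N by rewrite -ltnS prednK (leq_trans _ Nd) // (leq_trans N0).
have d0 : (0 < d)%N by rewrite (leq_trans _ Nd).
have dR : (0 : R) < d%:R by rewrite ltr0n.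
have d1R : (0 : R) < d.-1%:R by rewrite ltr0n.
have NR : (0 : R) < N%:R by rewrite ltr0n.
have [nnu|nun] := leqP n nu.
  rewrite subnn muln1; apply/orP; right; rewrite natrX lerXn2r ?nnegrE ?ler0n //.
    by rewrite -(prednK d0) -natr1; have := ler0n R d.-1; lra.
  by rewrite -[in leRHS](prednK d0) -natr1; lra.
apply/orP; left; rewrite natrM !natrX.
pose s : R := nu%:R / kappa%:R.
have s0 : 0 <= s by rewrite divr_ge0.
have -> : d%:R `^ (n%:R - nu%:R / kappa%:R + 1) * N%:R `^ (nu%:R / kappa%:R - 1)
  = d%:R ^+ n * (d%:R / N%:R) / (d%:R / N%:R) `^ s :> R.
  have dN : d%:R = d%:R / N%:R * N%:R :> R by rewrite divfK ?gt_eqF.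
  rewrite -/s addrAC !powRB ?(gt_eqF dR) ?(gt_eqF NR) ?implybT //.
  rewrite !powRr1 ?ler0n // powRD ?(gt_eqF dR) ?implybT // powR_mulrn ?ler0n //.
  rewrite powRr1 ?ler0n // [in X in _ / X * _]dN powRM ?divr_ge0 ?ler0n //.
  field; rewrite !gt_eqF ?powR_gt0 // divr_gt0 //.
have h1 : (d%:R / N%:R) `^ s <= (d%:R / d.-1%:R) ^+ nu :> R.
  have a0 : (0 : R) <= d%:R / d.-1%:R by rewrite divr_ge0.
  have -> : (d%:R / d.-1%:R) ^+ nu = ((d%:R / d.-1%:R) ^+ kappa) `^ s :> R.
    rewrite -!powR_mulrn // -powRrM /s mulrCA divff ?mulr1 //.
    by rewrite pnatr_eq0 -lt0n.
  by rewrite ge0_ler_powR // nnegrE ?divr_ge0 ?exprn_ge0.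
have h2 : (1 : R) <= d%:R / N%:R by rewrite ler_pdivlMr // mul1r ler_nat ltnW.
have p0 : 0 < (d%:R / N%:R) `^ s :> R by rewrite powR_gt0 // divr_gt0.
apply: (@le_trans _ _ (d%:R ^+ n / (d%:R / N%:R) `^ s)); last first.
  by rewrite ler_pM2r ?invr_gt0 // ler_peMr // exprn_ge0 // ltW.
rewrite ler_pdivlMr // -(subnK (ltnW nun)) exprD addnK.
apply: le_trans (ler_wpM2l _ h1) _.
  by rewrite mulr_ge0 // exprn_ge0 // ltW.
by rewrite expr_div_n mulrC mulrA divfK ?expf_neq0 ?gt_eqF // mulrC.
Qed.

Theorem proposition6p1 (R : realType) (S : set {poly R[i]}) (N : nat)
    (g : 'I_N -> {poly R[i]}) :
  polynomial_semigroup S ->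
  S = generated_semigroup g ->
  `I_2 #<= critical_points g ->
  let D : R := (degree_sum g)%:R in
  let M : R := max_derivative S g in
  let rho : R := D / N%:R in
  let lambda : R := ln rho / ln M in
  exists (r0 : R) (kappa : nat), 0 < r0 /\ (0 < kappa)%N /\
    let I (nu : nat) : set R :=
      [set r | r0 * rho `^ (- (2 * nu%:R / lambda)) < r
               <= r0 * rho `^ (- (2 * (nu%:R - 1) / lambda))] in
    forall (r : R) (y : R[i]), 0 < r <= r0 -> julia S (Some y) ->
    exists nu : nat,
      unique (fun mu : nat => (0 < mu)%N /\ I mu r) nu /\
      forall (n : nat) (z : R[i]),
        (preimage_count g n y z r)%:R
        <= Num.max
             (D `^ (n%:R - nu%:R / kappa%:R + 1)
              * N%:R `^ (nu%:R / kappa%:R - 1))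
             ((D - 1 / 2) ^+ n).
Proof.
move=> + SE; subst S => -[_ Sgt1 Slead [p0 Sp0 p0gt2]] critI D M rho lambda.
have Sg i : generated_semigroup g (g i).
  by exists [:: i] => //; rewrite /word_poly /= comp_polyXr.
have g_gt1 i : (1 < size (g i))%N := Sgt1 _ (Sg i).
have g_lead i : size (g i) = 2%N -> 1 < modulus (lead_coef (g i)) := Slead _ (Sg i).
(* A word in generators of degree one has degree one, so an element of degree at least 2 forces such
   a generator. *)
have [N0 [i0 gi0]] : (0 < N)%N /\ exists i, (2 < size (g i))%N.
  have [w w0 pE] := Sp0.
  have N0 : (0 < N)%N by case: (w) w0 => // -[i iN] _ _; exact: leq_ltn_trans iN.
  split=> //; apply: contrapT => /forallNP H.
  have := @degree_word_poly _ _ g w; rewrite -pE big1.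
    by case: (size p0) p0gt2 => [|[|[|]]].
  move=> i _; have := H i; have := g_gt1 i.
  by case: (size (g i)) => [|[|[|]]] //= k _ [].
have [[y0 Jy0]|noJ] :=
    pselect (exists y, julia (generated_semigroup g) (Some y)); last first.
  (* There is no [y] to treat: any positive constants do. *)
  by exists 1, 1%N; do 2!split=> //; move=> I r y _ Jy; case: noJ; exists y.
have [c1 [c2 [crit1 crit2 c12]]] : exists c1 c2,
    [/\ critical_points g c1, critical_points g c2 & c1 != c2].
  have /pcard_leP/injfunPex[f fcrit finj] := critI.
  exists (f 0%N), (f 1%N); split; [exact: fcrit | exact: fcrit |].
  by apply/eqP => /finj; rewrite !mem_setE => /(_ isT isT).
have M1 : 1 < M := max_derivative_gt1 g_gt1 g_lead crit1 crit2 c12 Jy0.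
have ND : (N < degree_sum g)%N by apply: degree_sum_gt => //; exists i0.
have [r1 r10 lip] := lipschitz_near_julia g_gt1 g_lead M1.
have d0 : 0 < modulus (c1 - c2) by rewrite modulus_gt0 subr_eq0.
(* The first bound serves the expansion estimate, the second keeps a disc from containing both
   critical points. *)
pose r0 := Num.min r1 (modulus (c1 - c2) / 2).
have [r0r1 r0c] : r0 <= r1 /\ 2 * r0 <= modulus (c1 - c2).
  by rewrite mulrC -ler_pdivlMr // /r0 !ge_min !lexx orbT.
have D0 : (0 < degree_sum g)%N by rewrite (leq_ltn_trans _ ND).
have D1R : (0 : R) < (degree_sum g).-1%:R.
  by rewrite ltr0n -ltnS prednK (leq_ltn_trans _ ND).
have rho1 : 1 < rho by rewrite ltr_pdivlMr ?ltr0n // mul1r ltr_nat.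
have a1 : 1 < D / (degree_sum g).-1%:R.
  by rewrite ltr_pdivlMr // mul1r ltr_nat ltn_predL.
(* This gives (1 - 1/D)^kappa < N/D; then [kappa] is positive because rho > 1. *)
have [kappa kP] := exprn_unbounded rho a1.
have k0 : (0 < kappa)%N.
  by case: kappa kP => // ; rewrite expr0 ltNge (ltW rho1).
exists r0, kappa; split; first by rewrite lt_min r10 divr_gt0.
split=> //.
move=> I r y rr0 Jy.
have q1 : 1 < M ^+ 2 by rewrite exprn_egt1.
have [nu [nuU nuP]] := scale_index q1 rr0.
exists nu; split.
  have IE mu : I mu r =
      (r0 * (M ^+ 2) `^ (- mu%:R) < r <= r0 * (M ^+ 2) `^ (- (mu%:R - 1))).
    by rewrite /I /= -!(powR_scale _ rho1 M1).
  have [[nu0 nuI] nuM] := nuU.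
  by split=> [|mu [mu0 muI]]; [rewrite IE | apply: nuM; rewrite -IE].
move=> n z; rewrite preimage_count_disc //.
apply: le_trans (count_bound n nu N0 ND k0 (ltW kP)); rewrite ler_nat.
apply: (preimage_count_in_small g_gt1 n z Jy _ _ (lt_trans ltr01 q1) nuP).
  move=> i w a x Ja wa wx; apply: (lip i w a x Ja).
    exact: lt_le_trans wa r0r1.
  exact: lt_le_trans wx r0r1.
by move=> w; apply: (fiber_not_in_small_disc g_gt1 w crit1 crit2).
Qed.
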